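(* For any $n$-vertex graph $G$, the set $P$ returned by the algorithm Parallel-Peeling$(G)$ (described in the context) is a vertex cover of $G$ whose size is $O(\log n)$ times the minimum vertex cover size of $G$, with probability at least $1-O(1/n)$.
   Context: Let $G=(V,E)$ have $n$ vertices; logarithms are base 2. Removing a set of vertices from a graph means deleting them and all incident edges. Degree thresholds: $\Delta_1:=n$, $\Delta_i:=n^{1/2^{i-1}}$, so that $\Delta_{i+1}=\sqrt{\Delta_i}$, for $\tau=O(\log\log n)$ phases, where the last threshold is set to $\Delta_\tau:=4\log n$; and $\Delta_{\tau+1}:=\sqrt{\Delta_\tau}$. Subroutine Local-Peeling$(H,\Delta)$: let $t_{\max}$ be the smallest integer with $\Delta/2^{t_{\max}}\le 4\log n$; set $H_1:=H$; for $t=1,\dots,t_{\max}$, let $Q_t$ be the set of vertices of degree at least $\Delta/2^{t+1}$ in $H_t$ and $H_{t+1}:=H_t$ with $Q_t$ removed; return $\bigcup_t Q_t$. Algorithm Parallel-Peeling$(G)$: set $G_1:=G$. For each phase $i=1,\dots,\tau$: let $k_i:=\Delta_{i+1}$ and $p_i:=4\log n/\Delta_{i+1}$; independently for each $j\in[k_i]$ choose a set $V^{(j)}_i\subseteq V$ by including each vertex of $G$ independently with probability $p_i$, and let $G^{(j)}_i$ be the subgraph of $G_i$ induced on $V^{(j)}_i$; in parallel compute $P^{(j)}_i:=$ Local-Peeling$(G^{(j)}_i,\,p_i\Delta_i)$; let $P_i:=\bigcup_j P^{(j)}_i$ and $G_{i+1}:=G_i$ with $P_i$ removed; then remove from $G_{i+1}$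 every vertex of degree more than $\Delta_{i+1}$ and add these vertices to $P_i$ as well. Finally compute an $O(1)$-approximate vertex cover $P_{\tau+1}$ of $G_{\tau+1}$ and return $P:=\bigcup_{i=1}^{\tau+1}P_i$. *)

(* Defs.v *)
From HB Require Import structures.
From mathcomp Require Import all_boot all_order all_algebra.
From mathcomp Require Import all_classical all_reals all_analysis.

Set Implicit Arguments.
Unset Strict Implicit.
Unset Printing Implicit Defensive.

Import Order.TTheory GRing.Theory Num.Theory.
Local Open Scope ring_scope.

(* MathComp and MathComp-Analysis, with an arbitrary R : realType as the reals. *)

Definition log2 (R : realType) (x : R) : R := ln x / ln 2.

(* The least natural number satisfying P; 0 if there is none. *)
Definition least (P : nat -> Prop) : nat :=
  xget 0%N [set m | P m /\ forall l, P l -> (m <= l)%N]%classic.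

Lemma leastP (P : nat -> Prop) :
  (exists m, P m) -> P (least P) /\ forall l, P l -> (least P <= l)%N.
Proof.
move=> exP; have exP' : exists m, `[<P m>] by case: exP => m Pm; exists m; apply/asboolP.
rewrite /least; case: xgetP => [m _ //|no].
case: (ex_minnP exP') => m /asboolP Pm minm; case: (no m); split => // l Pl.
by apply: minm; apply/asboolP.
Qed.

(* A finite simple graph is a symmetric irreflexive edge relation e on a finite
   type T.  Every graph met by the algorithm is an induced subgraph e[S], and is
   represented by its vertex set S. *)
Section Graphs.
Context (T : finType) (e : rel T).
Implicit Types S C : {set T}.

Definition degree S (v : T) : nat := #|[set u in S | e v u]|.

Definition vertex_cover S C : bool :=
  (C \subset S) &&
  [forall u in S, forall v in S, e u v ==> (u \in C) || (v \in C)].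

Definition min_vc S : nat := #|[arg min_(C < S | vertex_cover S C) #|C| ]|.

Definition approx_vertex_cover (R : realType) (alpha : R)
    (A : {set T} -> {set T}) : Prop :=
  forall S, vertex_cover S (A S) /\ #|A S|%:R <= alpha * (min_vc S)%:R.

End Graphs.

Section Thresholds.
Context (R : realType) (n : nat).

Definition root_threshold (i : nat) : R := n%:R `^ (2 ^- i.-1).

(* The number tau of phases: the first i >= 1 with n^(1/2^(i-1)) <= 4 log n.
   Its threshold Delta_tau is then reset to 4 log n. *)
Definition num_phases : nat :=
  least (fun i => (0 < i)%N /\ root_threshold i <= 4 * log2 n%:R).

Definition Delta (i : nat) : R :=
  if (i < num_phases)%N then root_threshold i
  else if i == num_phases then 4 * log2 n%:R
  else Num.sqrt (4 * log2 n%:R).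

(* Delta_(i+1) need not be an integer: it is rounded up. *)
Definition num_samples (i : nat) : nat := `|Num.ceil (Delta i.+1)|%N.

Definition sample_rate (i : nat) : R := 4 * log2 n%:R / Delta i.+1.

(* sample_rate exceeds 1 in the last phase; it is truncated at 1 only where it
   is used as a probability. *)
Definition sample_prob (i : nat) : R := Num.min 1 (sample_rate i).

Definition peel_rounds (D : R) : nat :=
  least (fun t => D / 2 ^+ t <= 4 * log2 n%:R).

End Thresholds.

Section Algorithm.
Context (R : realType) (T : finType) (e : rel T).

Local Notation n := #|T|.
Local Notation Delta := (Delta R n).

Section LocalPeeling.
Context (H : {set T}) (D : R).

(* peel_high t S is Q_t when S is the vertex set of H_t. *)
Definition peel_high (t : nat) (S : {set T}) : {set T} :=
  [set v in S | D / 2 ^+ t.+1 <= (degree e S v)%:R].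

(* The vertex set of H_(t+1), that is, of H after rounds 1, ..., t. *)
Fixpoint peel_rest (t : nat) : {set T} :=
  if t is t'.+1 then peel_rest t' :\: peel_high t (peel_rest t') else H.

Definition local_peeling : {set T} :=
  \bigcup_(1 <= t < (peel_rounds n D).+1) peel_high t (peel_rest t.-1).

End LocalPeeling.

Section ParallelPeeling.
(* V i j is the sample V_i^(j), for 1 <= i <= tau and 1 <= j <= k_i; A is the
   procedure applied to the last graph. *)
Context (V : nat -> nat -> {set T}) (A : {set T} -> {set T}).

Definition phase_peeled (i : nat) (S : {set T}) : {set T} :=
  \bigcup_(1 <= j < (num_samples R n i).+1)
     local_peeling (S :&: V i j) (sample_rate R n i * Delta i).

(* P_i, when S is the vertex set of G_i. *)
Definition phase_removed (i : nat) (S : {set T}) : {set T} :=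
  let S' := S :\: phase_peeled i S in
  phase_peeled i S :|: [set v in S' | Delta i.+1 < (degree e S' v)%:R].

(* The vertex set of G_(i+1), that is, of G after phases 1, ..., i. *)
Fixpoint phase_rest (i : nat) : {set T} :=
  if i is i'.+1 then phase_rest i' :\: phase_removed i (phase_rest i')
  else [set: T].

Definition parallel_peeling : {set T} :=
  (\bigcup_(1 <= i < (num_phases R n).+1) phase_removed i (phase_rest i.-1))
  :|: A (phase_rest (num_phases R n)).

End ParallelPeeling.
End Algorithm.

Section Sampling.
Context (R : realType) (T : finType).

Local Notation n := #|T|.

(* The pairs (i, j) with i < tau and j < k_(i+1); such a pair indexes the
   sample V_(i+1)^(j+1). *)
Definition sample_index : finType :=
  {i : 'I_(num_phases R n) & 'I_(num_samples R n i.+1)}.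

Definition outcome : finType := {ffun sample_index -> {set T}}.

(* The joint law of the samples: the product, over all indices (i, j) and all
   vertices v, of Bernoulli laws deciding whether v belongs to V_i^(j). *)
Definition outcome_prob (w : outcome) : R :=
  \prod_(x : sample_index) \prod_(v : T)
    (if v \in w x then sample_prob R n (tag x).+1
     else 1 - sample_prob R n (tag x).+1).

Definition Pr (E : pred outcome) : R := \sum_(w : outcome | E w) outcome_prob w.

(* The samples numbered from 1; the value off the index range is irrelevant. *)
Definition samples (w : outcome) (i j : nat) : {set T} :=
  if [pick x : sample_index | ((tag x).+1 == i) && ((tagged x).+1 == j)]
    is Some x then w x else finset.set0.

End Sampling.

Lemma log2_nat_ge0 (R : realType) (n : nat) : 0 <= log2 (n%:R : R).
Proof.
rewrite /log2; case: n => [|n]; first by rewrite ln0 // mul0r.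
by rewrite divr_ge0 // ln_ge0 // ler1n.
Qed.

Lemma Delta_ge0 (R : realType) (n i : nat) : 0 <= Delta R n i.
Proof.
rewrite /Delta; case: ifP => _; first exact: powR_ge0.
by case: ifP => _; rewrite ?sqrtr_ge0 // mulr_ge0 // log2_nat_ge0.
Qed.

Lemma sample_prob_itv (R : realType) (n i : nat) : 0 <= sample_prob R n i <= 1.
Proof.
rewrite /sample_prob ge_min lexx le_min ler01 /= andbT /sample_rate.
by rewrite divr_ge0 ?Delta_ge0 // mulr_ge0 // log2_nat_ge0.
Qed.

Lemma num_phasesP (R : realType) (n : nat) : (1 < n)%N ->
  [/\ (0 < num_phases R n)%N,
      root_threshold R n (num_phases R n) <= 4 * log2 n%:R
    & forall i, (0 < i < num_phases R n)%N ->
        4 * log2 n%:R < root_threshold R n i].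
Proof.
move=> n_gt1.
have [|[h1 h2] hmin] := @leastP
  (fun i => (0 < i)%N /\ root_threshold R n i <= 4 * log2 n%:R); last first.
  split=> // i /andP[i_gt0 lti]; rewrite ltNge; apply/negP => hi.
  by have := hmin i (conj i_gt0 hi); rewrite leqNgt lti.
have n1 : 1 <= n%:R :> R by rewrite ler1n ltnW.
have ln2_gt0 : 0 < ln 2 :> R by rewrite ln_gt0 // ltr1n.
exists n.+1; split=> //; rewrite /root_threshold /=.
have le2 : n%:R `^ (2 ^- n) <= 2 :> R.
  have E : 2 = (2 ^+ (2 ^ n)) `^ (2 ^- n) :> R.
    rewrite -(powR_mulrn (2 ^ n) (ler0n R 2)) -powRrM natrX.
    by rewrite mulfV ?powRr1 // expf_neq0 // pnatr_eq0.
  rewrite [leRHS]E; apply: ge0_ler_powR; rewrite ?nnegrE ?invr_ge0 ?exprn_ge0 //.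
  rewrite -natrX ler_nat (leq_trans (ltnW (ltn_expl n (ltnSn 1)))) //.
  by rewrite ltnW // ltn_expl.
apply: (le_trans le2); rewrite /log2 mulrA ler_pdivlMr //.
apply: ler_pM; rewrite ?ler_nat // ?(ltW ln2_gt0) //.
by rewrite ler_ln ?posrE ?ltr0n ?ler_nat // ltnW.
Qed.

Lemma Pr_total (R : realType) (T : finType) : Pr (R := R) (T := T) predT = 1.
Proof.
rewrite /Pr /outcome_prob.
rewrite -(bigA_distr_bigA (fun (x : sample_index R T) (X : {set T}) =>
  \prod_(v : T) (if v \in X then sample_prob R #|T| (tag x).+1
     else 1 - sample_prob R #|T| (tag x).+1))).
apply: big1 => x _; rewrite -bigA_distr.
by apply: big1 => v _; rewrite [LHS]addrCA subrr addr0.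
Qed.

(* Main.v *)
Require Import Defs.
From mathcomp Require Import all_boot all_order all_algebra.
From mathcomp Require Import all_classical all_reals all_analysis.
From mathcomp Require Import ring lra zify.

(* Fix a minimum cover O.  The local peelings of a phase all follow one
   deterministic reference peeling of the bipartite graph between O and its
   complement, which removes vertices of O at a degree threshold a constant
   factor above, and the others at one a constant factor below, the threshold of
   the algorithm.  By Chernoff bounds, in every sample the vertices of O are
   removed no later and those outside O no earlier than in the reference
   peeling.  Hence the vertices outside O removed in a phase are among those
   removed by the reference peeling; counting edges, each of its rounds removes
   O(|O|) of them, and the numbers of rounds of all phases but the last add up to
   at most 2 log n because log Delta_i - log Delta_(i+1) telescopes. *)

Set Implicit Arguments.
Unset Strict Implicit.
Unset Printing Implicit Defensive.

Import Order.TTheory GRing.Theory Num.Theory.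
Local Open Scope ring_scope.

(** * Graphs and local peeling *)

Lemma in_bigcup_seq (T : finType) (I : Type) (r : seq I) (F : I -> {set T}) v :
  (v \in \bigcup_(i <- r) F i) = has (fun i => v \in F i) r.
Proof.
by elim: r => [|i r IH]; rewrite ?big_nil ?big_cons !inE //= IH.
Qed.

Lemma in_bigcup_nat1 (T : finType) m (F : nat -> {set T}) v :
  reflect (exists2 t, (t < m)%N & v \in F t.+1)
          (v \in \bigcup_(1 <= t < m.+1) F t).
Proof.
rewrite in_bigcup_seq; apply: (iffP hasP) => [[[|t]]|[t ltm vF]].
- by rewrite mem_index_iota.
- by rewrite mem_index_iota => /andP[_ ltm] vF; exists t.
- by exists t.+1; rewrite ?mem_index_iota.
Qed.

Section Degree.
Context (T : finType).
Implicit Types (e : rel T) (S O : {set T}).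

Lemma degree_mono e e' S S' v :
  (forall u, u \in S -> e v u -> u \in S' /\ e' v u) ->
  (degree e S v <= degree e' S' v)%N.
Proof.
move=> sub; apply/subset_leq_card/fintype.subsetP => u.
by rewrite !inE => /andP[uS vu]; have [-> ->] := sub u uS vu.
Qed.

(** Double counting: an edge counted at its end in [X] has its other end in [Y], and is counted
    again from there because [X] lies in [S] and [e] is symmetric. *)
Lemma sum_degree e S (X Y : {set T}) : symmetric e -> X \subset S ->
  (forall u v, u \in X -> v \in S -> e u v -> v \in Y) ->
  (\sum_(u in X) degree e S u <= \sum_(v in Y) degree e S v)%N.
Proof.
move=> e_sym /fintype.subsetP XS XY.
have degE u Z : degree e Z u = (\sum_(v in Z) e u v)%N.
  by rewrite /degree -sum1dep_card big_mkcondr.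
under eq_bigr do rewrite degE.
under [leqRHS]eq_bigr do rewrite degE.
rewrite [leqRHS]exchange_big [leqRHS](bigID (mem X)) /=.
apply: leq_trans (leq_addr _ _).
rewrite [leqRHS](eq_bigl (mem X)) => [|u]; last first.
  by rewrite /= andb_idl // => /XS.
apply: leq_sum => u uX; rewrite [leqLHS]big_mkcond [leqRHS]big_mkcond /=.
apply: leq_sum => v _; rewrite (e_sym v u).
by case: ifP => // vS; case euv: (e u v) => //; rewrite (XY u v).
Qed.

End Degree.

Section LocalPeeling.
Context (R : realType) (T : finType) (e : rel T).

Lemma peel_rest_sub (H : {set T}) (D : R) t s : (t <= s)%N ->
  peel_rest e H D s \subset peel_rest e H D t.
Proof.
elim: s => [|s IH]; first by rewrite leqn0 => /eqP->.
rewrite leq_eqVlt => /orP[/eqP-> //|/IH]; apply: fintype.subset_trans.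
exact: finset.subsetDl.
Qed.

Lemma local_peelingE (H : {set T}) (D : R) :
  local_peeling e H D = H :\: peel_rest e H D (peel_rounds #|T| D).
Proof.
apply/finset.setP => v; rewrite /local_peeling.
elim: (peel_rounds _ _) => [|m IH]; first by rewrite big_geq // !inE andNb.
rewrite big_nat_recr //= inE {}IH 3!inE.
have := fintype.subsetP (peel_rest_sub H D (leq0n m)) v.
rewrite /peel_high !inE.
by case: (v \in H); case: (v \in peel_rest _ _ _ _); case: (_ <= _) => //= ->.
Qed.

End LocalPeeling.

(** * The reference peeling *)

Section Reference.
Context (R : realType) (T : finType) (e : rel T) (O : {set T}).
Implicit Types (S V : {set T}) (D : R).

(** Edges inside [O] are dropped: a sample may peel vertices of [O] earlier than the reference does,
    so only neighbours outside [O] can be relied on to keep the degree of a vertex of [O] high. *)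
Definition cross : rel T := fun u v => e u v && ((u \in O) (+) (v \in O)).

(* The algorithm compares sampled degrees with p * D / 2^(t+1); the factors 8 and
   1/128 leave the room needed for a failure probability of n^-4. *)
Definition ref_threshold D t v : R :=
  if v \in O then 8 * (D / 2 ^+ t) else (D / 2 ^+ t) / 128.

Fixpoint ref_rest S D t : {set T} :=
  if t is t'.+1 then
    [set v in ref_rest S D t' |
      (degree cross (ref_rest S D t') v)%:R < ref_threshold D t v]
  else S.

(** The two harmful deviations in round [t.+1]: the reference removes a vertex of [O] whose sampled
    degree misses the threshold of the algorithm, or keeps a vertex outside [O] whose sampled degree
    reaches it. That threshold in round [t.+1] has exponent [t.+2]. As [W] does not depend on [V],
    Chernoff bounds apply to fixed neighbourhoods. *)
Definition ref_fails S D D' V t v : bool :=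
  let W := ref_rest S D t in
  let d := (degree cross W v)%:R : R in
  let d' := (degree cross (W :&: V) v)%:R : R in
  if v \in O then (ref_threshold D t.+1 v <= d) && (d' < D' / 2 ^+ t.+2)
  else (d < ref_threshold D t.+1 v) && (D' / 2 ^+ t.+2 <= d').

Hypothesis e_sym : symmetric e.
Hypothesis O_cover : vertex_cover e [set: T] O.

Lemma cross_sym : symmetric cross.
Proof. by move=> u v; rewrite /cross e_sym addbC. Qed.

Lemma coverP u v : e u v -> u \notin O -> v \in O.
Proof.
move=> euv /negbTE uO; case/andP: O_cover =>
  _ /forall_inP/(_ u (finset.in_setT _)).
by move=> /forall_inP/(_ v (finset.in_setT _)); rewrite euv uO.
Qed.

Lemma crossE u v : u \notin O -> cross u v = e u v.
Proof.
move=> uO; rewrite /cross (negbTE uO) /=.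
by case: (boolP (e u v)) => // /coverP ->.
Qed.

Lemma cross_cover S (X : {set T}) : X \subset S -> [disjoint X & O] ->
  (\sum_(v in X) degree cross S v <= \sum_(v in S :&: O) degree cross S v)%N.
Proof.
move=> XS dXO; apply: sum_degree => // [|u v uX vS]; first exact: cross_sym.
have uO : u \notin O by rewrite (disjointFr dXO).
by rewrite crossE // => /coverP/(_ uO) vO; rewrite inE vS.
Qed.

(** * Comparison of a sampled peeling with the reference peeling *)

Section Sandwich.
Context (S V : {set T}) (D D' : R) (m : nat).
Hypothesis ok : forall t v, (t < m)%N -> ~~ ref_fails S D D' V t v.

(** Each inclusion feeds the other. A vertex of [O] has in the sample at least its sampled reference
    neighbours, by the second inclusion, so the sample removes it whenever the reference does. A
    vertex outside [O] has all its neighbours in [O], hence by the first inclusion at most its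
    sampled reference degree, so it stays whenever the reference keeps it. *)
Lemma sandwich t : (t <= m)%N ->
  (peel_rest e (S :&: V) D' t :&: O \subset ref_rest S D t) /\
  (ref_rest S D t :&: V :\: O \subset peel_rest e (S :&: V) D' t).
Proof.
elim: t => [|t IH] ltm /=.
  by split; apply/fintype.subsetP => v; rewrite !inE => /andP[] // /andP[].
have [/fintype.subsetP subO /fintype.subsetP subN] := IH (ltnW ltm).
have subV : peel_rest e (S :&: V) D' t \subset V.
  by apply: fintype.subset_trans (peel_rest_sub e _ _ (leq0n t)) _;
    exact: finset.subsetIr.
split; apply/fintype.subsetP => v; rewrite /peel_high !inE.
  move=> /andP[/andP[+ vH] vO].
  rewrite vH subO ?inE ?vH //= => low; rewrite ltNge; apply: contra low => high.
  have := ok v ltm; rewrite /ref_fails vO high /= -leNgt => /le_trans; apply.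
  rewrite ler_nat; apply: degree_mono => u; rewrite inE => /andP[uW uV].
  rewrite /cross vO => /andP[-> uO]; split => //.
  by apply: subN; rewrite !inE uW uV -addTb uO.
move=> /andP[vO /andP[/andP[vW low] vV]].
have vH : v \in peel_rest e (S :&: V) D' t by apply: subN; rewrite !inE vO vW.
rewrite vH andbT /= -ltNge.
have := ok v ltm; rewrite /ref_fails (negbTE vO) low /= -ltNge;
  apply: le_lt_trans.
rewrite ler_nat; apply: degree_mono => u uH evu; rewrite crossE //; split => //.
by rewrite inE subO ?inE ?uH ?(coverP evu) //=; exact: (fintype.subsetP subV).
Qed.

End Sandwich.

(** * Number of vertices outside the cover removed by the reference peeling *)

Section Sizes.
Context (S : {set T}) (D : R).
Hypothesis D_gt0 : 0 < D.
Hypothesis degS : forall v, v \in S -> (degree e S v)%:R <= D.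

(** For [t > 0] a survivor passed the previous threshold test; for [t = 0] the bound is [degS].
    Outside [O] the factor 1/128 is weakened to 1 so that both cases fit. *)
Lemma ref_degree t v : v \in ref_rest S D t ->
  (degree cross (ref_rest S D t) v)%:R <=
  (if v \in O then 8 else 1) * (D / 2 ^+ t).
Proof.
case: t => [|t] /= vW.
  rewrite expr0 divr1; apply: (@le_trans _ _ D).
    apply: le_trans (degS vW); rewrite ler_nat.
    by apply: degree_mono => u uS /andP[].
  by case: ifP => _; rewrite ler_peMl ?(ltW D_gt0) ?ler1n.
move: (vW); rewrite inE => /andP[vW' /ltW low].
apply: le_trans (le_trans _ low) _.
  rewrite ler_nat; apply: degree_mono => u uW vu; split => //.
  by move: uW; rewrite inE => /andP[].
rewrite /ref_threshold; case: ifP => _ //; rewrite mul1r ler_pdivrMr //.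
by rewrite ler_peMr ?ler1n // divr_ge0 ?(ltW D_gt0) ?exprn_ge0.
Qed.

(** Each removed vertex outside [O] has at least [D / 2 ^+ t.+1 / 128] cross edges, all ending in
    [O], where degrees are at most [8 * (D / 2 ^+ t)]. The ratio is 8 * 2 * 128 = 2048. *)
Lemma ref_round_size t :
  (#|(ref_rest S D t :\: ref_rest S D t.+1) :\: O|)%:R <= 2048 * (#|O|)%:R :> R.
Proof.
set X := _ :\: O; set W := ref_rest S D t.
have DX : 0 < D / 2 ^+ t.+1 / 128 by rewrite !divr_gt0 ?exprn_gt0.
rewrite -(ler_pM2r DX).
have XW : X \subset W.
  by apply/fintype.subsetP => v; rewrite !inE => /andP[_] /andP[].
have dXO : [disjoint X & O].
  by rewrite finset.disjoints_subset; apply/fintype.subsetP => v;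
    rewrite !inE => /andP[].
apply: (@le_trans _ _ (\sum_(v in X) degree cross W v)%:R).
  rewrite mulr_natl -sumr_const natr_sum; apply: ler_sum => v.
  rewrite /X /= !inE /ref_threshold => /andP[/negbTE-> /andP[+ vW]].
  by rewrite vW /= -leNgt.
apply: (@le_trans _ _ (\sum_(v in W :&: O) degree cross W v)%:R).
  by rewrite ler_nat; exact: cross_cover.
rewrite natr_sum; apply: (@le_trans _ _ (\sum_(v in W :&: O) 8 * (D / 2 ^+ t))).
  apply: ler_sum => v; rewrite inE => /andP[vW vO].
  by have := ref_degree vW; rewrite vO.
rewrite sumr_const -[leLHS]mulr_natl.
have -> : 2048 * #|O|%:R * (D / 2 ^+ t.+1 / 128) = #|O|%:R * (8 * (D / 2 ^+ t)).
  by rewrite exprS invfM; lra.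
rewrite ler_wpM2r ?mulr_ge0 ?divr_ge0 ?(ltW D_gt0) ?exprn_ge0 //.
by rewrite ler_nat subset_leq_card // finset.subsetIr.
Qed.

Lemma ref_size t :
  (#|(S :\: ref_rest S D t) :\: O|)%:R <= 2048 * t%:R * (#|O|)%:R :> R.
Proof.
elim: t => [|t IH]; first by rewrite finset.setDv finset.set0D cards0 mulr0 mul0r.
apply: (@le_trans _ _ (#|(S :\: ref_rest S D t) :\: O|
          + #|(ref_rest S D t :\: ref_rest S D t.+1) :\: O|)%:R).
  rewrite ler_nat; apply: leq_trans (leq_card_setU _ _).
  apply/subset_leq_card/fintype.subsetP => v; rewrite !inE.
  by do 4?[case: (_ \in _)]; case: (_ < _)%R.
rewrite natrD; have := ref_round_size t; rewrite -natr1; lra.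
Qed.

End Sizes.
End Reference.

(** * Chernoff bounds for the samples *)

Section ProductLaw.
Context (R : realType) (T : finType).
Local Notation n := #|T|.
Local Notation outcome := (outcome R T).
Local Notation sample_index := (sample_index R T).
Local Notation prob x := (sample_prob R n (tag (x : sample_index)).+1).

Definition expect (f : outcome -> R) : R := \sum_w outcome_prob w * f w.

Lemma outcome_prob_ge0 (w : outcome) : 0 <= outcome_prob w.
Proof.
apply: prodr_ge0 => x _; apply: prodr_ge0 => v _.
by have /andP[p0 p1] := sample_prob_itv R n (tag x).+1; case: ifP;
  rewrite ?subr_ge0.
Qed.

Lemma PrE (E : pred outcome) : Pr E = expect (fun w => (E w)%:R).
Proof.
rewrite /Pr big_mkcond; apply: eq_bigr => w _.
by case: (E w); rewrite ?mulr1 ?mulr0.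
Qed.

Lemma Pr_le_expect (E : pred outcome) (f : outcome -> R) :
  (forall w, (E w)%:R <= f w) -> Pr E <= expect f.
Proof.
move=> le_f; rewrite PrE; apply: ler_sum => w _.
by rewrite ler_wpM2l ?outcome_prob_ge0.
Qed.

Lemma Pr_has (I : Type) (r : seq I) (E : pred outcome) (F : I -> pred outcome) :
  (forall w, E w -> has (F^~ w) r) -> Pr E <= \sum_(i <- r) Pr (F i).
Proof.
move=> EF; under eq_bigr do rewrite PrE.
rewrite /expect exchange_big; under eq_bigr do rewrite -mulr_sumr.
apply: Pr_le_expect => w; case Ew: (E w); last by apply: sumr_ge0.
rewrite -natr_sum ler_nat; move: (EF w Ew); elim: r {EF} => //= i r IH.
by rewrite big_cons; case: (F i w) => //= /IH; rewrite add0n.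
Qed.

Lemma Pr_has_le (I : eqType) (r : seq I) (F : I -> pred outcome) (c : R) :
  (forall i, i \in r -> Pr (F i) <= c) ->
  Pr (fun w => has (F^~ w) r) <= (size r)%:R * c.
Proof.
move=> le_c; apply: (le_trans (@Pr_has _ r _ F _)) => //.
rewrite -sum1_size natr_sum mulr_suml big_seq [leRHS]big_seq.
by apply: ler_sum => i /le_c; rewrite mul1r.
Qed.

Lemma Pr_or (E F : pred outcome) : Pr (fun w => E w || F w) <= Pr E + Pr F.
Proof.
apply: le_trans (@Pr_has _ [:: true; false] _ (fun b => if b then E else F) _) _.
  by move=> w /=; rewrite orbF.
by rewrite !big_cons big_nil addr0.
Qed.

Lemma Pr_not (E : pred outcome) : Pr E = 1 - Pr (fun w => ~~ E w).
Proof.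
have <- : Pr (fun _ : outcome => true) = 1 by exact: Pr_total.
by rewrite /Pr [X in _ = X - _](bigID E) /= addrK.
Qed.

Lemma Pr_ge0 (E : pred outcome) : 0 <= Pr E.
Proof. by apply: sumr_ge0 => w _; exact: outcome_prob_ge0. Qed.

Lemma expectZ (a : R) (f : outcome -> R) :
  expect (fun w => f w * a) = expect f * a.
Proof. by rewrite /expect mulr_suml; apply: eq_bigr => w _; rewrite mulrA. Qed.

(** Independence of all the membership bits: expanding the product of two-term sums gives one term
    per outcome. *)
Lemma expect_prod (h : sample_index -> T -> bool -> R) :
  expect (fun w => \prod_x \prod_v h x v (v \in w x)) =
  \prod_x \prod_v (prob x * h x v true + (1 - prob x) * h x v false).
Proof.
under eq_bigr do rewrite bigA_distr.
rewrite bigA_distr_bigA; apply: eq_bigr => w _.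
rewrite /outcome_prob -big_split; apply: eq_bigr => x _ /=.
rewrite -big_split; apply: eq_bigr => v _ /=.
by case: ifP.
Qed.

(* Exchanging the coordinates outside D of two independent outcomes preserves
   their joint law. *)
Lemma Pr_decouple (D : pred sample_index) (E : outcome -> outcome -> bool) (eps
  : R) :
  (forall w1 w2 w1' w2' : outcome, (forall x, D x -> w1 x = w1' x) ->
     (forall x, ~~ D x -> w2 x = w2' x) ->
     E w1 w2 = E w1' w2') ->
  (forall w, Pr (E w) <= eps) -> Pr (fun w => E w w) <= eps.
Proof.
move=> depE le_eps.
pose mix (w w' : outcome) : outcome := [ffun x => if D x then w x else w' x].
pose swap p := (mix p.1 p.2, mix p.2 p.1).
have swapK : involutive swap.
  move=> [w w']; congr pair; apply/ffunP => x; rewrite !ffunE /= ?ffunE;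
    case: (D x) => //=.
have mu_mix : forall w w', outcome_prob (mix w w') * outcome_prob (mix w' w)
    = outcome_prob w * outcome_prob w'.
  move=> w w'; rewrite /outcome_prob -!big_split; apply: eq_bigr => x _ /=.
  by rewrite !ffunE; case: ifP => //; rewrite mulrC.
have tot : \sum_(w : outcome) outcome_prob w = 1 by exact: Pr_total.
(* A second, independent outcome is introduced by multiplying by its total mass 1. *)
have -> : Pr (fun w => E w w) = expect (fun w => Pr (E w)).
  transitivity (\sum_(p : outcome * outcome)
    outcome_prob p.1 * outcome_prob p.2 * (E p.1 p.1)%:R).
    rewrite -(pair_bigA _ (fun w w' : outcome =>
      outcome_prob w * outcome_prob w' * (E w w)%:R)).
    rewrite PrE; apply: eq_bigr => w _ /=; rewrite -mulr_suml -mulr_sumr.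
    by rewrite tot mulr1.
  (* After the swap both arguments of [E] are [mix w w'], which agrees with [w] on [D] and with [w']
     off [D]; by [depE] they can be replaced by [w] and [w']. *)
  rewrite (reindex_inj (inv_inj swapK)) /=.
  transitivity (\sum_(p : outcome * outcome)
    outcome_prob p.1 * outcome_prob p.2 * (E p.1 p.2)%:R).
    apply: eq_bigr => -[w w'] _ /=; rewrite mu_mix;
      congr (_ * (nat_of_bool _)%:R).
    by apply: depE => x; rewrite ffunE; case: (D x).
  rewrite -(pair_bigA _ (fun w w' : outcome =>
    outcome_prob w * outcome_prob w' * (E w w')%:R)).
  apply: eq_bigr => w _; rewrite PrE /expect mulr_sumr.
  by apply: eq_bigr => w' _; rewrite mulrA.
rewrite -[eps]mul1r -tot mulr_suml; apply: ler_sum => w _.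
by rewrite ler_wpM2l ?outcome_prob_ge0.
Qed.

(** The probability generating function of a binomial variable. *)
Lemma expect_expn_card (x : sample_index) (N : {set T}) (y : R) :
  expect (fun w => y ^+ #|N :&: w x|) = (1 + prob x * (y - 1)) ^+ #|N|.
Proof.
pose h x' v b := if [&& x' == x, v \in N & b] then y else 1.
transitivity (expect (fun w => \prod_x' \prod_v h x' v (v \in w x'))).
  apply: eq_bigr => w _; congr (_ * _).
  rewrite (bigD1 x) //= [X in _ * X]big1 ?mulr1 => [|x' /negbTE x'x]; last first.
    by apply: big1 => v _; rewrite /h x'x.
  rewrite -prodr_const [LHS]big_mkcond; apply: eq_bigr => v _.
  by rewrite /h eqxx inE.
rewrite expect_prod (bigD1 x) //= [X in _ * X]big1 ?mulr1 => [|x' /negbTE x'x].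
  rewrite -prodr_const [RHS]big_mkcond; apply: eq_bigr => v _.
  by rewrite /h eqxx; case: (v \in N) => /=; lra.
by apply: big1 => v _; rewrite /h x'x /=; lra.
Qed.

Lemma ln2_ge_half : 2^-1 <= ln 2 :> R.
Proof.
have half : (1 + - 2^-1) * expR 2^-1 <= 1 :> R.
  by rewrite -[leRHS](expRxMexpNx_1 2^-1) mulrC ler_wpM2l ?expR_ge0 ?expR_ge1Dx.
rewrite -ler_expR lnK ?posrE //; lra.
Qed.

Lemma ln2_le1 : ln 2 <= 1 :> R.
Proof.
by rewrite -ler_expR lnK ?posrE //; apply: le_trans (expR_ge1Dx 1); lra.
Qed.

(** Exponential moment with base 32, that is [expR (5 * ln 2)]. Its expectation is at most
    [expR (31 * p * #|N|)], hence at most [expR (theta / 2)], which costs one of the five factors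
    [ln 2] since [ln 2] is at least 1/2. *)
Lemma sampled_upper_tail (x : sample_index) (N : {set T}) (theta : R) :
  62 * (prob x * #|N|%:R) <= theta ->
  Pr (fun w : outcome => theta <= #|N :&: w x|%:R) <= expR (- (4 * ln 2 * theta)).
Proof.
move=> small.
apply: le_trans (@Pr_le_expect _
  (fun w => (32 : R) ^+ #|N :&: w x| * expR (- (5 * ln 2 * theta))) _) _.
  move=> w /=; have [high|_] := leP theta #|N :&: w x|%:R.
    have -> : 32 = expR (5 * ln 2) :> R.
      by rewrite expRM_natl lnK ?posrE //; ring.
    rewrite -expRM_natr -expRD -[leLHS]expR0 ler_expR -mulrBr mulr_ge0
      ?subr_ge0 //.
    by have := ln2_ge_half; lra.
  by rewrite mulr_ge0 ?exprn_ge0 ?expR_ge0.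
rewrite expectZ expect_expn_card.
have /andP[p0 p1] := sample_prob_itv R n (tag x).+1.
have theta0 : 0 <= theta by apply: le_trans small; rewrite !mulr_ge0.
apply: (@le_trans _ _ (expR (theta / 2) * expR (- (5 * ln 2 * theta)))).
  rewrite ler_wpM2r ?expR_ge0 //.
  apply: (@le_trans _ _ (expR (prob x * (32 - 1)) ^+ #|N|)).
    rewrite lerXn2r ?nnegrE ?expR_ge0 ?expR_ge1Dx //.
    by rewrite addr_ge0 // mulr_ge0 //; lra.
  rewrite -expRM_natr ler_expR; lra.
rewrite -expRD ler_expR; have := ler_wpM2r theta0 ln2_ge_half; lra.
Qed.

(** Exponential moment with base 1/2: its expectation is at most [expR (- (5 * theta))], and the
    Markov factor is [expR (ln 2 * theta)]. The claim follows from [ln 2 <= 1]. *)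
Lemma sampled_lower_tail (x : sample_index) (N : {set T}) (theta : R) :
  0 <= theta -> 10 * theta <= prob x * #|N|%:R ->
  Pr (fun w : outcome => #|N :&: w x|%:R < theta) <= expR (- (4 * ln 2 * theta)).
Proof.
move=> theta0 large.
apply: le_trans (@Pr_le_expect _
  (fun w => (2^-1 : R) ^+ #|N :&: w x| * expR (ln 2 * theta)) _) _.
  move=> w /=; have [low|_] := ltP #|N :&: w x|%:R theta.
    have -> : 2^-1 = expR (- ln 2) :> R by rewrite expRN lnK ?posrE.
    rewrite -expRM_natr -expRD -[leLHS]expR0 ler_expR mulNr addrC -mulrBr.
    by rewrite mulr_ge0 ?subr_ge0 ?(ltW low) //; have := ln2_ge_half; lra.
  by rewrite mulr_ge0 ?exprn_ge0 ?expR_ge0.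
rewrite expectZ expect_expn_card.
have /andP[p0 p1] := sample_prob_itv R n (tag x).+1.
apply: (@le_trans _ _ (expR (- (5 * theta)) * expR (ln 2 * theta))).
  rewrite ler_wpM2r ?expR_ge0 //.
  apply: (@le_trans _ _ (expR (prob x * (2^-1 - 1)) ^+ #|N|)).
    by rewrite lerXn2r ?nnegrE ?expR_ge0 ?expR_ge1Dx //; lra.
  rewrite -expRM_natr ler_expR; lra.
rewrite -expRD ler_expR; have := ler_wpM2r theta0 ln2_le1; lra.
Qed.

Lemma samplesE (w : outcome) (x : sample_index) :
  samples w (tag x).+1 (tagged x).+1 = w x.
Proof.
rewrite /samples; case: pickP => [y|/(_ x)]; last by rewrite !eqxx.
rewrite !eqSS => /andP[]; case: x y => [i j] [i' j'] /= /eqP /val_inj ii'.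
(* The type of the second component depends on the first, so the first equality is eliminated before
   the second is used. *)
by case: _ / ii' j => j /eqP /val_inj ->.
Qed.

Lemma samples_index i j :
  (i < num_phases R n)%N -> (j < num_samples R n i.+1)%N ->
  exists x : sample_index, tag x = i :> nat /\
    forall w : outcome, samples w i.+1 j.+1 = w x.
Proof.
move=> lti ltj.
pose x : sample_index :=
  Tagged (fun i : 'I_(num_phases R n) => 'I_(num_samples R n i.+1))
    (i := Ordinal lti) (Ordinal ltj).
by exists x; split => // w; exact: (samplesE w x).
Qed.

Lemma eq_samples (w w' : outcome) i j :
  (forall x : sample_index, (tag x).+1 = i -> w x = w' x) ->
  samples w i j = samples w' i j.
Proof.
move=> eq_ww'; rewrite /samples; case: pickP => // x /andP[/eqP ix _].
exact: eq_ww'.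
Qed.

(** The event is dominated by a product over all bits that vanishes as soon as [v] enters a sample
    of the phase. Its expectation is (1 - p)^k, at most exp(-pk). *)
Lemma Pr_unsampled i v : (i < num_phases R n)%N ->
  Pr (fun w : outcome =>
    [forall x : sample_index, (tag x == i :> nat) ==> (v \notin w x)])
  <= expR (- (sample_prob R n i.+1 * (num_samples R n i.+1)%:R)).
Proof.
move=> lti.
pose h (x : sample_index) u b : R :=
  if [&& tag x == i :> nat, u == v & b] then 0 else 1.
apply: le_trans (@Pr_le_expect _ (fun w =>
  \prod_x \prod_u h x u (u \in w x)) _) _.
  move=> w /=; case: (boolP [forall x, _]) => [/forallP none|_]; last first.
    apply: prodr_ge0 => x _; apply: prodr_ge0 => u _.
    by rewrite /h; case: ifP.
  rewrite big1 // => x _; apply: big1 => u _; rewrite /h.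
  case: ifP => // /and3P[ix /eqP-> vw].
  by have /implyP/(_ ix) := none x; rewrite vw.
rewrite expect_prod; set F := BIG_F.
have FE x : F x = if tag x == i :> nat then 1 - sample_prob R n i.+1 else 1.
  rewrite /F (bigD1 v) //= big1 => [|u /negbTE uv].
    by rewrite mulr1 /h eqxx /= !andbF andbT;
      case: (tag x =P i :> nat) => [->|_]; lra.
  by rewrite /h uv /= andbF; lra.
have -> : \prod_x F x = \prod_(i' < num_phases R n)
    \prod_(j < num_samples R n i'.+1)
      (if i' == i :> nat then 1 - sample_prob R n i.+1 else 1).
  by rewrite [RHS]sig_big_dep; apply: eq_bigr => x _; exact: FE.
rewrite (bigD1 (Ordinal lti)) //= [X in _ * X]big1 => [|i' neq]; last first.
  by apply: big1 => j _; case: ifP => // /eqP ii'; move: neq;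
    rewrite -val_eqE /= ii' eqxx.
rewrite eqxx prodr_const card_ord mulr1 -mulNr expRM_natr.
have /andP[p0 p1] := sample_prob_itv R n i.+1.
by rewrite lerXn2r ?nnegrE ?expR_ge0 ?subr_ge0 // expR_ge1Dx.
Qed.

End ProductLaw.

(** * Thresholds and numbers of rounds *)

Section ThresholdFacts.
Context (R : realType) (n : nat).
Hypothesis n_gt1 : (1 < n)%N.
Local Notation L := (log2 n%:R : R).
Local Notation tau := (num_phases R n).
Local Notation Delta := (Delta R n).
Local Notation rounds i := (peel_rounds n (sample_rate R n i * Delta i)).

Lemma ln2_gt0 : 0 < ln 2 :> R.
Proof. by rewrite ln_gt0 // ltr1n. Qed.

Lemma mul_log2 (x : R) : log2 x * ln 2 = ln x.
Proof. by rewrite /log2 divfK // gt_eqF ?ln2_gt0. Qed.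

Lemma log2_nat_ge1 : 1 <= L.
Proof.
by rewrite -(ler_pM2r ln2_gt0) mul_log2 mul1r ler_ln ?posrE ?ltr0n ?ler_nat //
  ltnW.
Qed.

Lemma log2_nat_le : L <= n%:R.
Proof.
rewrite -(ler_pM2r ln2_gt0) mul_log2 mulr_natl -lnXn // ler_ln ?posrE
  ?exprn_gt0 ?ltr0n 1?ltnW //.
by rewrite -natrX ler_nat ltnW // ltn_expl.
Qed.

Lemma num_phases_gt0 : (0 < tau)%N.
Proof. by have [] := num_phasesP R n_gt1. Qed.

Lemma DeltaE i : (i < tau)%N -> Delta i = root_threshold R n i.
Proof. by rewrite /Defs.Delta => ->. Qed.

Lemma Delta_last : Delta tau = 4 * L.
Proof. by rewrite /Defs.Delta ltnn eqxx. Qed.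

Lemma root_threshold_decr i : root_threshold R n i.+1 <= root_threshold R n i.
Proof.
rewrite /root_threshold ler_powR ?ler1n 1?ltnW // lef_pV2 ?posrE ?exprn_gt0 //.
by rewrite ler_weXn2l ?ler1n // leq_pred.
Qed.

Lemma Delta_ge i : (0 < i <= tau)%N -> 4 * L <= Delta i.
Proof.
move=> /andP[i_gt0]; rewrite leq_eqVlt => /orP[/eqP->|lti];
  first by rewrite Delta_last.
have [_ _ gtL] := num_phasesP R n_gt1.
by rewrite DeltaE // ltW // gtL // i_gt0.
Qed.

Lemma Delta_gt0 i : (0 < i <= tau)%N -> 0 < Delta i.
Proof. by move=> /Delta_ge; have := log2_nat_ge1; lra. Qed.

Lemma Delta_decr i : (0 < i < tau)%N -> Delta i.+1 <= Delta i.
Proof.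
move=> /andP[i_gt0 lti].
move: (lti); rewrite leq_eqVlt => /orP[/eqP eqi|lti1].
  by rewrite eqi Delta_last Delta_ge // i_gt0 ltnW.
by rewrite !DeltaE // root_threshold_decr.
Qed.

Lemma root_threshold1 : root_threshold R n 1 = n%:R.
Proof. by rewrite /root_threshold expr0 invr1 powRr1. Qed.

(** Only an inequality: when there is a single phase, [Delta 1] is reset to 4 log n, which is then
    at least n. *)
Lemma Delta1_ge : n%:R <= Delta 1.
Proof.
have [tau_gt0 tauP _] := num_phasesP R n_gt1.
move: tau_gt0; rewrite leq_eqVlt => /orP[/eqP eq1|gt1].
  by rewrite {1}eq1 Delta_last; move: tauP; rewrite -eq1 root_threshold1.
by rewrite DeltaE // root_threshold1.
Qed.

Lemma Delta_le i : (0 < i < tau)%N -> Delta i <= n%:R.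
Proof.
elim: i => // -[_ lti|i IH lti].
  by rewrite DeltaE // root_threshold1.
by apply: le_trans (Delta_decr _) (IH _); rewrite /= ltnW.
Qed.

Lemma num_samples_le i : (0 < i < tau)%N -> (num_samples R n i <= n)%N.
Proof.
move=> iP; rewrite -(ler_nat int) /num_samples natz.
have Di : Delta i.+1 <= n%:R by exact: le_trans (Delta_decr iP) (Delta_le iP).
rewrite gez0_abs; first by rewrite Num.Theory.ceil_le_int rmorph_nat.
by rewrite Num.Theory.ceil_ge0 (lt_le_trans _ (Delta_ge0 R n i.+1)) ?ltrN10.
Qed.

(** Before the last phase the next threshold is at least 4 log n, so the truncation at 1 has no
    effect. *)
Lemma sample_probE i : (0 < i < tau)%N -> sample_prob R n i = 4 * L / Delta i.+1.
Proof.
move=> /andP[_ lti]; rewrite /sample_prob /sample_rate; apply/min_idPr.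
by rewrite ler_pdivrMr ?mul1r ?Delta_ge // Delta_gt0.
Qed.

Lemma peel_roundsP (D : R) : 0 <= D ->
  D / 2 ^+ peel_rounds n D <= 4 * L /\
  forall t, (t < peel_rounds n D)%N -> 4 * L < D / 2 ^+ t.
Proof.
move=> D0; have [|le4 minr] := @leastP (fun t => D / 2 ^+ t <= 4 * L).
  exists (Num.bound D); rewrite ler_pdivrMr ?exprn_gt0 //.
  apply: le_trans (ltW (Num.Theory.archi_boundP D0)) _.
  apply: (@le_trans _ _ (2 ^+ Num.bound D));
    first by rewrite -natrX ler_nat ltnW // ltn_expl.
  by rewrite ler_peMl ?exprn_ge0 //; have := log2_nat_ge1; lra.
split=> // t ltt; rewrite ltNge; apply/negP => /minr.
by rewrite leqNgt ltt.
Qed.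

Lemma scaled_Delta_ge0 i : 0 <= sample_rate R n i * Delta i.
Proof.
by rewrite mulr_ge0 ?divr_ge0 ?Delta_ge0 // mulr_ge0 // log2_nat_ge0.
Qed.

(** This is the stopping rule of the local peeling divided by the sampling rate
    [4 * L / Delta i.+1]. *)
Lemma peel_end i : (0 < i < tau)%N -> Delta i / 2 ^+ rounds i <= Delta i.+1.
Proof.
move=> /andP[i_gt0 lti]; have D1 : 0 < Delta i.+1 by rewrite Delta_gt0.
have [+ _] := peel_roundsP (scaled_Delta_ge0 i); set t := rounds i.
have L0 : 0 < 4 * L by have := log2_nat_ge1; lra.
rewrite -(ler_pM2l L0 (Delta i / _)) /sample_rate => le1.
rewrite -ler_pdivrMr //; apply: le_trans le1.
by rewrite le_eqVlt; apply/orP; left; apply/eqP; ring.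
Qed.

(** By minimality, one round less still leaves [Delta i / 2 ^+ t] above [Delta i.+1]; logarithms
    give the bound, the 1 being that missing round. With no rounds at all, monotonicity of [Delta]
    suffices. *)
Lemma rounds_le i : (0 < i < tau)%N ->
  (rounds i)%:R <= 1 + (log2 (Delta i) - log2 (Delta i.+1)).
Proof.
move=> iP; have /andP[i_gt0 lti] := iP.
have D1 : 0 < Delta i.+1 by rewrite Delta_gt0.
have D0 : 0 < Delta i by rewrite Delta_gt0 // i_gt0 ltnW.
rewrite -(ler_pM2r ln2_gt0) mulrDl mulrBl !mul_log2 mul1r.
have [_] := peel_roundsP (scaled_Delta_ge0 i);
  case: (rounds i) => [_|t /(_ t (leqnn _))].
  rewrite mul0r addr_ge0 ?(ltW ln2_gt0) // subr_ge0 ler_ln ?posrE //.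
  exact: Delta_decr.
have L0 : 0 < 4 * L by have := log2_nat_ge1; lra.
rewrite ltr_pdivlMr ?exprn_gt0 // -[ltRHS]mulrA ltr_pM2l // ltr_pdivlMl // =>
  /ltW.
rewrite -ler_ln ?posrE ?mulr_gt0 ?exprn_gt0 // lnM ?posrE ?exprn_gt0 // lnXn //.
by rewrite -mulr_natl -natr1; lra.
Qed.

(** The last threshold before the reset exceeds 4. For [tau = i.+2] it is n^(1/2^i), so 2^(i+1) is
    at most log n. This bound, weaker than log log n, is enough to absorb one extra round per
    phase. *)
Lemma num_phases_le : tau%:R <= 1 + L.
Proof.
have [] := num_phasesP R n_gt1; case: tau => // -[|i] _ _ gtL.
  by have := log2_nat_ge1; lra.
rewrite -natr1 addrC lerD2l; have := gtL i.+1 (leqnn _).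
have lt4 : 4 <= 4 * L by have := log2_nat_ge1; lra.
move=> /(le_lt_trans lt4) /ltW.
rewrite /root_threshold /= -ler_ln ?posrE ?powR_gt0 ?ltr0n 1?ltnW // ln_powR.
rewrite (_ : 4 = 2 ^+ 2); last by ring.
rewrite lnXn // mulrC ler_pdivlMr ?exprn_gt0 //.
rewrite (_ : _ * _ = 2 ^+ i.+1 * ln 2); last by rewrite exprS; ring.
rewrite -[ln n%:R]mul_log2 ler_pM2r ?ln2_gt0 //; apply: le_trans.
by rewrite -natrX ler_nat ltnW // ltn_expl.
Qed.

(** One L bounds the [tau - 1] extra rounds, the other the telescoping sum, which starts at log n
    and ends at a nonnegative term. *)
Lemma sum_rounds_le : \sum_(1 <= i < tau) (rounds i)%:R <= 2 * L.
Proof.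
have := num_phases_gt0; rewrite leq_eqVlt => /orP[/eqP <-|gt1].
  by rewrite big_geq //; have := log2_nat_ge1; lra.
apply: (@le_trans _ _ (\sum_(1 <= i < tau)
  (1 - (log2 (Delta i.+1) - log2 (Delta i))))).
  rewrite big_nat [leRHS]big_nat; apply: ler_sum => i iP.
  by apply: le_trans (rounds_le iP) _; lra.
rewrite big_split /= sumrN telescope_sumr 1?ltnW // sumr_const_nat.
rewrite (DeltaE gt1) root_threshold1 Delta_last natrB ?num_phases_gt0 //.
have : 0 <= log2 (4 * L) :> R.
  by rewrite -(pmulr_lge0 _ ln2_gt0) mul_log2 ln_ge0 //; have := log2_nat_ge1;
    lra.
have := num_phases_le; lra.
Qed.

End ThresholdFacts.

(** * Deterministic analysis of the phases *)

Section VertexCover.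
Context (T : finType) (e : rel T).

Lemma vertex_coverT (S : {set T}) : vertex_cover e S S.
Proof.
by rewrite /vertex_cover subxx; apply/forall_inP => u uS;
  apply/forall_inP => v _; rewrite uS implybT.
Qed.

Lemma min_vc_ex (S : {set T}) :
  exists2 O : {set T}, vertex_cover e S O & #|O| = min_vc e S.
Proof.
rewrite /min_vc; case: arg_minnP => [|O OS _]; first exact: vertex_coverT.
by exists O.
Qed.

Lemma min_vc_le (S O : {set T}) : vertex_cover e S O -> (min_vc e S <= #|O|)%N.
Proof.
rewrite /min_vc; case: arg_minnP => [|O' _ minO' /minO' //].
exact: vertex_coverT.
Qed.

Lemma vertex_cover_sub (S S' O : {set T}) : S' \subset S -> vertex_cover e S O ->
  vertex_cover e S' (S' :&: O).
Proof.
move=> /fintype.subsetP S'S /andP[_ /forall_inP cov].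
rewrite /vertex_cover finset.subsetIl; apply/forall_inP => u uS'.
apply/forall_inP => v vS'; rewrite !inE uS' vS'.
by have /forall_inP/(_ v (S'S v vS')) := cov u (S'S u uS').
Qed.

End VertexCover.

Section Phases.
Context (R : realType) (T : finType) (e : rel T).
Local Notation n := #|T|.
Local Notation L := (log2 n%:R : R).
Local Notation tau := (num_phases R n).
Local Notation Delta := (Delta R n).
Local Notation scaled_Delta i := (sample_rate R n i * Delta i).
Local Notation rounds i := (peel_rounds n (scaled_Delta i)).
Implicit Types (S : {set T}) (V : nat -> nat -> {set T}) (A : {set T} -> {set T}).

(** Holds for every choice of samples: an edge with no end removed in any phase survives to the last
    graph, where [A] covers it. *)
Lemma parallel_peeling_cover V A :
  (forall S, vertex_cover e S (A S)) ->
  vertex_cover e [set: T] (parallel_peeling R e V A).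
Proof.
move=> covA.
have restE m v : v \notin phase_rest R e V m ->
    v \in \bigcup_(1 <= i < m.+1) phase_removed R e V i (phase_rest R e V i.-1).
  elim: m => [|m IH]; first by rewrite inE.
  rewrite big_nat_recr //= finset.in_setD finset.in_setU negb_and negbK =>
    /orP[->|/IH->//].
  by rewrite orbT.
rewrite /vertex_cover finset.subsetT; apply/forall_inP => u _;
  apply/forall_inP => v _.
apply/implyP => euv; rewrite /parallel_peeling 2!inE.
case: (boolP (u \in phase_rest R e V tau)) => [ur|/restE -> //].
case: (boolP (v \in phase_rest R e V tau)) => [vr|/restE ->];
  last by rewrite orbT.
have /andP[_ /forall_inP/(_ u ur)/forall_inP/(_ v vr)] :=
  covA (phase_rest R e V tau).
by rewrite euv => /orP[]->; rewrite !orbT.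
Qed.

Lemma degree_le S v : (degree e S v <= n)%N.
Proof. exact: max_card. Qed.

Lemma phase_rest_degree V i v : (1 < n)%N -> v \in phase_rest R e V i ->
  (degree e (phase_rest R e V i) v)%:R <= Delta i.+1.
Proof.
move=> n_gt1; case: i => [|i] /=.
  by move=> _; apply: le_trans (Delta1_ge R n_gt1); rewrite ler_nat degree_le.
set S := phase_rest R e V i; rewrite finset.in_setD => /andP[+ vS].
rewrite finset.in_setU finset.in_set finset.in_setD vS andbT negb_or.
move=> /andP[-> /=]; rewrite -leNgt; apply: le_trans.
rewrite ler_nat; apply: degree_mono => u uS vu; split => //.
by move: uS; rewrite !inE negb_or => /andP[/andP[-> _] ->].
Qed.

(** The graph entering a phase is determined by the samples of earlier phases, which is what permits
    decoupling. *)
Lemma eq_phase_rest V V' i : (forall l j, (0 < l <= i)%N -> V l j = V' l j) ->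
  phase_rest R e V i = phase_rest R e V' i.
Proof.
elim: i => [//|i IH eqV].
have eq_rest : phase_rest R e V i = phase_rest R e V' i.
  by apply: IH => l j /andP[l0 li]; apply: eqV; rewrite l0 ltnW.
have eq_peeled S : phase_peeled R e V i.+1 S = phase_peeled R e V' i.+1 S.
  by apply: eq_bigr => j _; rewrite eqV ?ltnSn.
by cbn [phase_rest]; rewrite eq_rest /phase_removed eq_peeled.
Qed.

Lemma phase_removed_degree V i S v : 0 < scaled_Delta i ->
  v \in phase_removed R e V i S -> v \in S /\ (0 < degree e S v)%N.
Proof.
move=> D0; rewrite /phase_removed finset.in_setU =>
  /orP[/in_bigcup_nat1[j _]|]; last first.
  rewrite finset.in_set finset.in_setD => /andP[/andP[_ vS] high]; split => //.
  rewrite -(ltr_nat R); apply: le_lt_trans (Delta_ge0 R n i.+1)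
    (lt_le_trans high _).
  by rewrite ler_nat; apply: degree_mono => u; rewrite inE => /andP[].
move=> /in_bigcup_nat1[t _]; rewrite inE /= => /andP[vH high].
have sub := fintype.subsetP (peel_rest_sub e (S :&: V i j.+1) (scaled_Delta i)
  (leq0n t)).
have := sub v vH; rewrite inE => /andP[vS _]; split => //.
rewrite -(ltr_nat R); apply: lt_le_trans (le_trans high _).
  by rewrite divr_gt0 ?exprn_gt0.
rewrite ler_nat; apply: degree_mono => u /sub; by rewrite inE => /andP[].
Qed.

Section Cover.
Context (O : {set T}).
Hypothesis e_sym : symmetric e.
Hypothesis O_cover : vertex_cover e [set: T] O.

(* Besides a deviation from the reference peeling, a phase fails when some vertex
   is in none of its samples: it could then not be peeled. *)
Definition phase_fails (S : {set T}) (i : nat) (W : nat -> {set T}) : bool :=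
  has (fun j => has (fun t => has
      (ref_fails e O S (Delta i) (scaled_Delta i) (W j) t)
    (enum T)) (iota 0 (rounds i))) (iota 1 (num_samples R n i))
  || has (fun v => all (fun j => v \notin W j) (iota 1 (num_samples R n i)))
       (enum T).

(** For vertices removed by a local peeling this is the sandwich. For the final degree test, let [v]
    outside [O] survive the reference peeling. Its remaining neighbours lie in [O], and each, being
    in some sample and unpeeled there, also survives the reference peeling. So the degree of [v] is
    at most its final reference degree, which [peel_end] bounds by [Delta i.+1], and [v] passes the
    test. *)
Lemma phase_removed_sub V i S : (1 < n)%N -> (0 < i < tau)%N ->
  (forall v, v \in S -> (degree e S v)%:R <= Delta i) ->
  ~~ phase_fails S i (V i) ->
  phase_removed R e V i S :\: O \subset
    (S :\: ref_rest e O S (Delta i) (rounds i)) :\: O.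
Proof.
move=> n_gt1 iP degS; rewrite negb_or => /andP[okV sampled].
have [i_gt0 lti] := andP iP.
have ok j : (j < num_samples R n i)%N -> forall t v, (t < rounds i)%N ->
    ~~ ref_fails e O S (Delta i) (scaled_Delta i) (V i j.+1) t v.
  move=> ltj t v ltt; apply: contra okV => bad; apply/hasP; exists j.+1.
    by rewrite mem_iota add1n.
  apply/hasP; exists t; first by rewrite mem_iota.
  by apply/hasP; exists v; rewrite ?mem_enum.
have sand j ltj := sandwich O_cover (ok j ltj) (leqnn _).
set W := ref_rest _ _ _ _ _.
apply/fintype.subsetP => v; rewrite !finset.in_setD => /andP[vO]; rewrite vO /=.
rewrite finset.in_setU => /orP[/in_bigcup_nat1[j ltj]|].
  rewrite local_peelingE !inE => /andP[+ /andP[vS vV]]; rewrite vS andbT.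
  apply: contra => vW; have [_ /fintype.subsetP] := sand j ltj; apply.
  by rewrite !inE vO vW.
rewrite inE => /andP[vS' high]; have vS : v \in S by move: vS';
  rewrite inE => /andP[].
rewrite vS andbT; apply: contraL high => vW; rewrite -leNgt.
apply: le_trans (peel_end n_gt1 iP).
have D_gt0 : 0 < Delta i by rewrite Delta_gt0 // i_gt0 ltnW.
have := ref_degree D_gt0 degS vW; rewrite (negbTE vO) mul1r; apply: le_trans.
rewrite ler_nat; apply: degree_mono => u uS' evu; rewrite (crossE O_cover) //.
split => //; have uO := coverP O_cover evu vO.
have [j /andP[ltj uV]] : exists j, (j < num_samples R n i)%N && (u \in V i j.+1).
  move/hasPn/(_ u): sampled; rewrite mem_enum => /(_ isT) /allPn[[|j]].
    by rewrite mem_iota.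
  rewrite mem_iota add1n negbK => /andP[_ ltj] uV; exists j.
  by rewrite uV andbT.
have [/fintype.subsetP subO _] := sand j ltj; apply: subO.
move: uS'; rewrite !inE uO andbT => /andP[notp uS].
have : u \notin local_peeling e (S :&: V i j.+1) (scaled_Delta i).
  by apply: contra notp => up; apply/in_bigcup_nat1; exists j.
by rewrite local_peelingE !inE uS uV /= andbT negbK.
Qed.

Lemma phase_removed_size V i S : (1 < n)%N -> (0 < i < tau)%N ->
  (forall v, v \in S -> (degree e S v)%:R <= Delta i) ->
  ~~ phase_fails S i (V i) ->
  #|phase_removed R e V i S :\: O|%:R <= 2048 * (rounds i)%:R * #|O|%:R :> R.
Proof.
move=> n_gt1 iP degS ok; have [i_gt0 lti] := andP iP.
have D_gt0 : 0 < Delta i by rewrite Delta_gt0 // i_gt0 ltnW.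
apply: le_trans (ref_size e_sym O_cover D_gt0 degS (rounds i)).
by rewrite ler_nat subset_leq_card // phase_removed_sub.
Qed.

(* Every removed vertex had a neighbour, so outside O it is charged to one of
   the at most |O| * Delta_tau edges. *)
Lemma last_removed_size V S : (1 < n)%N ->
  (forall v, v \in S -> (degree e S v)%:R <= 4 * L) ->
  #|phase_removed R e V tau S :\: O|%:R <= 4 * L * #|O|%:R :> R.
Proof.
move=> n_gt1 degS; set X := _ :\: O.
have L0 : 0 < 4 * L by have := log2_nat_ge1 R n_gt1; lra.
have D0 : 0 < scaled_Delta tau.
  (* The index [tau.+1] falls in the square-root branch of [Delta]. *)
  rewrite /sample_rate Delta_last /Defs.Delta ltnNge leqnSn /= gtn_eqF //.
  by rewrite mulr_gt0 ?divr_gt0 ?sqrtr_gt0.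
have XP v : v \in X -> [/\ v \notin O, v \in S & (0 < degree e S v)%N].
  by rewrite finset.in_setD => /andP[vO /(phase_removed_degree D0)[]].
apply: (@le_trans _ _ (\sum_(v in X) degree (cross e O) S v)%:R).
  rewrite ler_nat -sum1_card; apply: leq_sum => v /XP[vO vS].
  suff -> : degree (cross e O) S v = degree e S v by [].
  by rewrite /degree; apply: eq_card => u; rewrite !inE (crossE O_cover).
apply: (@le_trans _ _ (\sum_(v in S :&: O) degree (cross e O) S v)%:R).
  rewrite ler_nat; apply: (cross_cover e_sym O_cover).
    by apply/fintype.subsetP => v /XP[].
  by rewrite finset.disjoints_subset; apply/fintype.subsetP => v /XP[vO _ _];
    rewrite inE.
rewrite natr_sum; apply: (@le_trans _ _ (\sum_(v in S :&: O) 4 * L)).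
  apply: ler_sum => v; rewrite inE => /andP[/degS + _]; apply: le_trans.
  by rewrite ler_nat; apply: degree_mono => u uS /andP[].
rewrite sumr_const -[leLHS]mulr_natr ler_wpM2l ?(ltW L0) //.
by rewrite ler_nat subset_leq_card // finset.subsetIr.
Qed.

(** The constant 4101 adds 1 for [O] itself, 2048 * 2 for the phases before the last and 4 for the
    last one; L being at least 1 absorbs the terms without logarithm. The absolute value covers a
    negative [alpha]. *)
Lemma parallel_peeling_size V A (alpha : R) : (1 < n)%N ->
  approx_vertex_cover e alpha A ->
  (forall i, (0 < i < tau)%N -> ~~ phase_fails (phase_rest R e V i.-1) i (V i)) ->
  #|parallel_peeling R e V A|%:R <= (4101 + `|alpha|) * L * #|O|%:R.
Proof.
move=> n_gt1 apxA ok; have L1 := log2_nat_ge1 R n_gt1.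
pose X i := phase_removed R e V i (phase_rest R e V i.-1).
have degS i : (0 < i)%N -> forall v, v \in phase_rest R e V i.-1 ->
    (degree e (phase_rest R e V i.-1) v)%:R <= Delta i.
  by case: i => // i _ v; exact: phase_rest_degree.
set B := A (phase_rest R e V tau).
have sizeB : #|B|%:R <= `|alpha| * #|O|%:R.
  have [_ /le_trans] := apxA (phase_rest R e V tau); apply.
  apply: (@le_trans _ _ (`|alpha| * (min_vc e (phase_rest R e V tau))%:R)).
    by rewrite ler_wpM2r // ler_norm.
  rewrite ler_wpM2l // ler_nat; apply: leq_trans (min_vc_le _) _.
    exact: vertex_cover_sub (finset.subsetT _) O_cover.
  by rewrite subset_leq_card // finset.subsetIr.
have sizeX : (\sum_(1 <= i < tau.+1) #|X i :\: O|)%:R <=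
    (4096 * L + 4 * L) * #|O|%:R.
  rewrite big_nat_recr ?num_phases_gt0 //= natrD mulrDl lerD //; last first.
    apply: last_removed_size => // v /degS; rewrite Delta_last; apply.
    exact: num_phases_gt0.
  rewrite natr_sum; apply: (@le_trans _ _
    (\sum_(1 <= i < tau) 2048 * (rounds i)%:R * #|O|%:R)).
    rewrite big_nat [leRHS]big_nat; apply: ler_sum => i iP.
    apply: phase_removed_size => //; last exact: ok.
    by apply: degS; case/andP: iP.
  rewrite -mulr_suml -mulr_sumr ler_wpM2r //.
  have := sum_rounds_le R n_gt1; lra.
have leq_size : (#|parallel_peeling R e V A| <=
    #|O| + \sum_(1 <= i < tau.+1) #|X i :\: O| + #|B|)%N.
  have sub : parallel_peeling R e V A \subset
      (O :|: \bigcup_(1 <= i < tau.+1) (X i :\: O)) :|: B.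
    apply/fintype.subsetP => v; rewrite inE =>
      /orP[/in_bigcup_nat1[i lti vX]|]; last first.
      by rewrite inE orbC => ->.
    rewrite 2!inE; case: (boolP (v \in O)) => //= vO.
    by apply/orP; left; apply/in_bigcup_nat1; exists i; rewrite // inE vO.
  apply: leq_trans (subset_leq_card sub) _.
  apply: leq_trans (leq_card_setU _ _) _; rewrite leq_add2r.
  apply: leq_trans (leq_card_setU _ _) _; rewrite leq_add2l.
  elim: (index_iota _ _) => [|i r IH]; first by rewrite !big_nil cards0.
  by rewrite !big_cons; apply: leq_trans (leq_card_setU _ _) _; rewrite leq_add2l.
apply: (@le_trans _ _ (#|O| + \sum_(1 <= i < tau.+1) #|X i :\: O| + #|B|)%:R).
  by rewrite ler_nat.
rewrite !natrD; apply: le_trans (lerD (lerD (lexx _) sizeX) sizeB) _.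
rewrite -{1}[#|O|%:R]mul1r -!mulrDl ler_wpM2r // [leRHS]mulrDl.
have : `|alpha| <= `|alpha| * L by rewrite ler_peMr.
lra.
Qed.

End Cover.
End Phases.

(** * Failure probability *)

Section Failure.
Context (R : realType) (T : finType) (e : rel T) (O : {set T}).
Local Notation n := #|T|.
Local Notation outcome := (outcome R T).
Local Notation L := (log2 n%:R : R).
Local Notation tau := (num_phases R n).
Local Notation Delta := (Delta R n).
Local Notation scaled_Delta i := (sample_rate R n i * Delta i).
Local Notation rounds i := (peel_rounds n (scaled_Delta i)).
Hypothesis n_gt1 : (1 < n)%N.

Let n_gt0 : 0 < n%:R :> R.
Proof. by rewrite ltr0n ltnW. Qed.

Lemma eq_Pr (E F : pred outcome) : E =1 F -> Pr E = Pr F.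
Proof. by move=> eqEF; apply: eq_bigl. Qed.

Lemma expR_ln_nat : expR (- (4 * ln n%:R)) = n%:R ^- 4 :> R.
Proof. by rewrite expRN expRM_natl lnK. Qed.

(** For fixed [S] the reference degree is a constant: either it excludes the event, or the event is
    a binomial tail at [theta]. Since round [t] has not met the stopping rule, [theta] is at least
    log n, and the tail is at most n^-4. *)
Lemma Pr_ref_fails (x : sample_index R T) (S : {set T}) i t v :
  (tag x).+1 = i -> (i < tau)%N -> (t < rounds i)%N ->
  Pr (fun w : outcome =>
    ref_fails e O S (Delta i) (scaled_Delta i) (w x) t v) <= n%:R ^- 4.
Proof.
move=> xi lti ltt; have iP : (0 < i < tau)%N by rewrite -xi in lti *.
have prob_x : sample_prob R n (tag x).+1 = sample_rate R n i.
  by rewrite xi sample_probE.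
have [_ /(_ t ltt)] := peel_roundsP n_gt1 (scaled_Delta_ge0 R n i).
set D' := scaled_Delta i => D't.
set theta := D' / 2 ^+ t.+2; set W := ref_rest e O S (Delta i) t.
have theta_ge : L <= theta by rewrite /theta !exprS !invfM; lra.
pose N := [set u in W | cross e O v u].
have degE (V : {set T}) : degree (cross e O) (W :&: V) v = #|N :&: V|.
  by apply: eq_card => u; rewrite !inE andbAC.
have bound : expR (- (4 * ln 2 * theta)) <= n%:R ^- 4 :> R.
  rewrite -expR_ln_nat ler_expR lerN2 -[ln n%:R]mul_log2.
  by have := ler_wpM2r (ltW (ln2_gt0 R)) theta_ge; lra.
apply: le_trans bound; rewrite /ref_fails /ref_threshold -/W -/theta.
have -> : degree (cross e O) W v = #|N| by [].
(* The mean sampled degree is thus at least 16 [theta] in the first case and at most [theta] / 64 in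
   the second, within the factors 10 and 62 of the tail bounds. *)
have thetaE : sample_rate R n i * (Delta i / 2 ^+ t.+1) = 2 * theta.
  by rewrite /theta /D' [2 ^+ t.+2]exprS invfM; lra.
have rate0 : 0 <= sample_rate R n i.
  by rewrite -prob_x; have /andP[] := sample_prob_itv R n (tag x).+1.
have L0 := log2_nat_ge0 R n.
case: ifP => _.
  have [high|_] := leP (8 * (Delta i / 2 ^+ t.+1)) #|N|%:R; last first.
    by rewrite /Pr big_pred0 // expR_ge0.
  under eq_Pr do rewrite degE.
  apply: sampled_lower_tail; first lra.
  by rewrite prob_x; have := ler_wpM2l rate0 high; rewrite mulrCA thetaE; lra.
have [low|_] := ltP #|N|%:R (Delta i / 2 ^+ t.+1 / 128); last first.
  by rewrite /Pr big_pred0 // expR_ge0.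
under eq_Pr do rewrite degE.
apply: sampled_upper_tail.
by rewrite prob_x; have := ler_wpM2l rate0 (ltW low);
  rewrite [leRHS]mulrA thetaE; lra.
Qed.

(** As the number of samples is [Delta i.+1] rounded up, its product with the sampling probability
    is at least 4 log n, which is at least 4 ln n. *)
Lemma Pr_never_sampled i v : (0 < i < tau)%N ->
  Pr (fun w : outcome =>
    all (fun j => v \notin samples w i j) (iota 1 (num_samples R n i)))
  <= n%:R ^- 4.
Proof.
case: i => // i /= lti; have iP : (0 < i.+1 < tau)%N by [].
apply: le_trans (le_trans (@Pr_unsampled R T i v (ltnW lti)) _).
  rewrite !PrE; apply: ler_sum => w _; rewrite ler_wpM2l ?outcome_prob_ge0 //.
  case: allP => // none; case: forallP => // -[] x; apply/implyP => /eqP xi.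
  have [j [ltj <-]] : exists j : nat, (j < num_samples R n i.+1)%N /\
      samples w i.+1 j.+1 = w x.
    by rewrite -xi; exists (tagged x); rewrite samplesE ltn_ord.
  by apply: none; rewrite mem_iota add1n.
rewrite -expR_ln_nat ler_expR lerN2 sample_probE // -[ln n%:R]mul_log2.
have D_gt0 : 0 < Delta i.+2 by rewrite Delta_gt0.
have kD : Delta i.+2 <= (num_samples R n i.+1)%:R.
  apply: le_trans (Num.Theory.ceil_ge _) _; rewrite natr_absz ler_int ler_norm //.
have L0 := log2_nat_ge0 R n.
apply: (@le_trans _ _ (4 * L)).
  by have := ler_wpM2l L0 (ln2_le1 R); lra.
rewrite -[leRHS]mulrA ler_peMr //; first lra.
by rewrite mulrC ler_pdivlMr ?mul1r.
Qed.

(** Union bound for a fixed [S]: at most n samples, the rounds and n vertices for deviations, then n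
    vertices for absence from all samples, each event having probability at most n^-4. *)
Lemma Pr_phase_fails (S : {set T}) i : (0 < i < tau)%N ->
  Pr (fun w : outcome => phase_fails R e O S i (samples w i))
    <= ((rounds i)%:R + 1) / n%:R ^+ 2.
Proof.
move=> iP; have /andP[i_gt0 lti] := iP.
apply: le_trans (Pr_or _ _) _.
apply: (@le_trans _ _ ((num_samples R n i)%:R *
    ((rounds i)%:R * (n%:R * n%:R ^- 4))
    + n%:R * n%:R ^- 4)).
  apply: lerD; last first.
    rewrite [X in X%:R * _]cardE.
    apply: (@Pr_has_le _ _ _ _ (fun v (w : outcome) =>
      all (fun j => v \notin samples w i j) (iota 1 (num_samples R n i)))) => v _.
    exact: Pr_never_sampled.
  rewrite -[X in X%:R * _](size_iota 1).
  apply: (@Pr_has_le _ _ _ _ (fun j (w : outcome) => has (fun t => has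
      (ref_fails e O S (Delta i) (scaled_Delta i) (samples w i j) t)
    (enum T)) (iota 0 (rounds i)))) => -[|j]; rewrite mem_iota // add1n => ltj.
  case: i iP i_gt0 lti ltj => // i iP _ lti ltj.
  have [x [xi xE]] := samples_index (ltnW lti) ltj.
  rewrite -[X in X%:R * _](size_iota 0).
  apply: (@Pr_has_le _ _ _ _ (fun t (w : outcome) => has
      (ref_fails e O S (Delta i.+1) (scaled_Delta i.+1) (samples w i.+1 j.+1) t)
    (enum T))) => t; rewrite mem_iota => ltt.
  rewrite [X in X%:R * _]cardE; apply: (@Pr_has_le _ _ _ _ (fun v (w : outcome) =>
    ref_fails e O S (Delta i.+1) (scaled_Delta i.+1) (samples w i.+1 j.+1)
      t v)) => v _.
  under eq_Pr do rewrite xE.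
  by apply: Pr_ref_fails => //; rewrite xi.
have n1 : 1 <= n%:R :> R by rewrite ler1n ltnW.
have nV : n%:R * n%:R ^- 4 = n%:R ^- 3 :> R.
  by rewrite [n%:R ^+ 4]exprS invfM mulVKf // gt_eqF.
rewrite nV mulrDl mul1r lerD //; last first.
  by rewrite lef_pV2 ?posrE ?exprn_gt0 // ler_weXn2l.
rewrite mulrCA ler_wpM2l //.
have -> : n%:R ^- 2 = n%:R * n%:R ^- 3 :> R.
  by rewrite [n%:R ^+ 3]exprS [(_ * _ ^+ 2)^-1]invfM mulVKf // gt_eqF.
by rewrite ler_wpM2r ?invr_ge0 ?exprn_ge0 // ler_nat num_samples_le.
Qed.

(** The rounds sum to at most 2L and the phases before the last number at most L, so the union bound
    gives 3L / n^2, and L is at most n. *)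
Lemma Pr_some_phase_fails :
  Pr (fun w : outcome => has (fun i =>
    phase_fails R e O (phase_rest R e (samples w) i.-1) i (samples w i))
      (index_iota 1 tau)) <= 3 / n%:R.
Proof.
apply: le_trans (@Pr_has _ _ _ _ _ (fun i w =>
  phase_fails R e O (phase_rest R e (samples w) i.-1) i (samples w i))
  (fun w => id)) _.
apply: (@le_trans _ _ (\sum_(1 <= i < tau) ((rounds i)%:R + 1) / n%:R ^+ 2)).
  rewrite big_nat [leRHS]big_nat; apply: ler_sum => i iP.
  (* The first outcome supplies the earlier phases, hence the graph; the second supplies the samples
     of phase [i]. With the first fixed, the bound for a fixed vertex set applies. *)
  apply: (@Pr_decouple _ _ (fun x => (tag x).+1 < i)%N (fun w1 w2 =>
    phase_fails R e O (phase_rest R e (samples w1) i.-1) i (samples w2 i)));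
      last first.
    by move=> w; exact: Pr_phase_fails.
  move=> w1 w2 w1' w2' eq1 eq2.
  rewrite (@eq_phase_rest _ _ _ (samples w1) (samples w1')) =>
    [|l j /andP[l_gt0 lel]].
    rewrite (_ : samples w2 i = samples w2' i) //; apply/funext => j.
    by apply: eq_samples => x xi; apply: eq2; rewrite xi ltnn.
  apply: eq_samples => x xi; apply: eq1; rewrite xi.
  by apply: leq_ltn_trans lel _; rewrite ltn_predL; case/andP: iP.
rewrite -mulr_suml big_split /= sumr_const_nat.
have := sum_rounds_le R n_gt1; have := num_phases_le R n_gt1.
have := log2_nat_le R n_gt1 => Ln taule sumle.
rewrite expr2 invfM mulrA ler_wpM2r ?invr_ge0 //.
rewrite ler_pdivrMr // natrB ?num_phases_gt0 //; lra.
Qed.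

End Failure.

Theorem theorem2 (R : realType) (alpha : R) :
  exists C c : R,
  forall (T : finType) (e : rel T) (A : {set T} -> {set T}),
    symmetric e -> irreflexive e -> approx_vertex_cover e alpha A ->
    1 - c / #|T|%:R <=
    Pr (fun w : outcome R T =>
          let P := parallel_peeling R e (samples w) A in
          vertex_cover e [set: T] P &&
          (#|P|%:R <= C * log2 #|T|%:R * (min_vc e [set: T])%:R)).
Proof.
exists (4101 + `|alpha|), 3 => T e A e_sym _ apxA.
have [n0 | [n1 | n_gt1]] : #|T| = 0%N \/ #|T| = 1%N \/ (1 < #|T|)%N by lia.
(* For n = 0 the quotient is 0 by convention, so probability 1 is required; all sets being empty,
   every outcome qualifies. *)
- rewrite n0 invr0 mulr0 subr0 -[leLHS](Pr_total R T).
  rewrite le_eqVlt; apply/orP; left; apply/eqP; apply: eq_Pr => w;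
    apply/esym/andP.
  have noT : forall X : {set T}, #|X| = 0%N.
    by move=> X; apply/eqP; rewrite -leqn0 -n0 max_card.
  split; first by apply: parallel_peeling_cover => S; have [] := apxA S.
  by rewrite noT /min_vc noT mulr0.
(* For n = 1 the claimed lower bound is 1 - 3, which is negative. *)
- by rewrite n1 divr1; apply: le_trans (Pr_ge0 _); lra.
have [X X_cover <-] := min_vc_ex e [set: T].
rewrite Pr_not lerD2l lerN2; apply: le_trans (Pr_some_phase_fails R e X n_gt1).
(* Outcome by outcome, a violated conclusion forces some phase before the last to fail. *)
rewrite !PrE; apply: ler_sum => w _;
  rewrite ler_wpM2l ?outcome_prob_ge0 // ler_nat.
case: (boolP (has _ _)) => [_|/hasPn ok]; first exact: leq_b1.
rewrite leqn0 eqb0 negbK; apply/andP; split.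
  by apply: parallel_peeling_cover => S; have [] := apxA S.
apply: parallel_peeling_size => // i iP; apply: ok.
by rewrite mem_index_iota.
Qed.
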